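(* For $k=1,2$, the map $\mathcal{A}_k$ is one-to-one on $\mathfrak{M}_L^k(\mathbb{R}^d)$: if $\nu,\nu'\in\mathfrak{M}_L^k(\mathbb{R}^d)$ and $\mathcal{A}_k(\nu)=\mathcal{A}_k(\nu')$, then $\nu=\nu'$.
   Context: A Lévy measure on $\mathbb{R}^d$ is a measure $\nu$ with $\nu(\{0\})=0$ and $\int(1\wedge|x|^2)\nu(\mathrm{d}x)<\infty$; their class is $\mathfrak{M}_L^2(\mathbb{R}^d)$, and $\mathfrak{M}_L^1(\mathbb{R}^d)$ is the class of Lévy measures with $\int(1\wedge|x|)\nu(\mathrm{d}x)<\infty$. For $s>0$ set $a_1(r;s)=2\pi^{-1}(s-r^2)^{-1/2}$ for $0<r<s^{1/2}$ and $0$ otherwise; $a_2(r;s)=2\pi^{-1}(s^2-r^2)^{-1/2}$ for $0<r<s$ and $0$ otherwise. For $k=1,2$, $\mathcal{A}_k(\nu)(B)=\int_{\mathbb{R}^d\setminus\{0\}}\nu(\mathrm{d}x)\int_0^\infty a_k(r;|x|)1_B(rx/|x|)\,\mathrm{d}r$, $B$ Borel. *)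

(* Defs.v *)
From HB Require Import structures.
From mathcomp Require Import all_boot all_order all_algebra.
From mathcomp Require Import all_classical all_reals all_analysis.
Set Implicit Arguments. Unset Strict Implicit. Unset Printing Implicit Defensive.
Import Order.TTheory GRing.Theory Num.Theory.
Import numFieldNormedType.Exports.
Local Open Scope classical_set_scope.
Local Open Scope ring_scope.

(* R^d as row vectors, with the Borel sigma-algebra (generated by the open
   sets of the usual (product) topology, which coincides with the Euclidean one). *)
Notation Rd R d := (g_sigma_algebraType (@open 'rV[R]_d)).

Definition enorm (R : realType) (d : nat) (x : 'rV[R]_d) : R :=
  Num.sqrt (\sum_(i < d) x ord0 i ^+ 2).

Definition levy_measure (R : realType) (d k : nat)
    (nu : {measure set (Rd R d) -> \bar R}) : Prop :=
  nu [set (0 : 'rV[R]_d)] = 0%E /\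
  (\int[nu]_(x in [set: Rd R d]) (Num.min 1 (enorm x ^+ k))%:E < +oo)%E.

Definition a_kern (R : realType) (k : nat) (r s : R) : R :=
  if k == 1%N then
    (if (0 < r) && (r < Num.sqrt s) then 2 / pi * (Num.sqrt (s - r ^+ 2))^-1 else 0)
  else
    (if (0 < r) && (r < s) then 2 / pi * (Num.sqrt (s ^+ 2 - r ^+ 2))^-1 else 0).

Definition A_op (R : realType) (d k : nat)
    (nu : {measure set (Rd R d) -> \bar R}) (B : set (Rd R d)) : \bar R :=
  (\int[nu]_(x in [set~ (0%R : 'rV[R]_d)])
     \int[@lebesgue_measure R]_(r in (`[0%R, +oo[%classic : set R))
        (a_kern k r (enorm x) * \1_B ((r / enorm x) *: x : Rd R d))%:E)%E.

(* Main.v *)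
(** Both kernels are the arcsine kernel on ]0, t[ with t = |x|^(1/2) for k = 1
    and t = |x| for k = 2.  For 0 < b < t,
      \int_b^t (2/pi) (t^2 - r^2)^(-1/2) r (r^2 - b^2)^(-1/2) dr = 1,
    so integrating the weight r (r^2 - b^2)^(-1/2) 1_(r > b), multiplied by
    1_C of the direction, against A_k(nu) recovers the nu-mass of the conical
    set {t > b, x/|x| in C}.  These sets, on which nu is finite, form a
    pi-system which together with {0} generates the Borel sets. *)
Require Import Defs.
From HB Require Import structures.
From mathcomp Require Import all_boot all_order all_algebra finmap.
From mathcomp Require Import all_classical all_reals all_analysis.
Import Order.TTheory GRing.Theory Num.Theory.
Import numFieldNormedType.Exports.
Local Open Scope classical_set_scope.
Local Open Scope ring_scope.
From mathcomp Require Import measurable_realfun ring lra.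

(** * Measurability of maps into and out of R^d *)

Lemma measurable_funRd (R : realType) (d : nat) (disp : measure_display)
    (T : measurableType disp) (D : set T) (f : T -> Rd R d) :
  (forall j, measurable_fun D (fun t => f t ord0 j)) -> measurable_fun D f.
Proof.
move=> mf mD; apply: (@measurability _ _ T (Rd R d) D f (@open 'rV[R]_d)) => //.
move=> _ [U oU <-].
(* An open set is the union of the rational boxes it contains; there are countably many, and the
   preimage of a box is a finite intersection of coordinate conditions. *)
pose box (q : 'rV[rat]_d * 'rV[rat]_d) : set 'rV[R]_d :=
  [set y | forall j, ratr (q.1 ord0 j) < y ord0 j < ratr (q.2 ord0 j)].
have -> : U = \bigcup_q (if `[<box q `<=` U>] then box q else set0).
  apply/seteqP; split=> [y Uy|y [q _]]; last by case: asboolP => // + bq; exact.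
  have /nbhs_ballP[e /= e0 eU] : nbhs y U by exact: open_nbhs_nbhs.
  have lo j : {q : rat | ratr q \in `]y ord0 j - e, y ord0 j[}.
    by apply: cid; apply: rat_in_itvoo; rewrite ltrBlDr ltrDl.
  have hi j : {q : rat | ratr q \in `]y ord0 j, y ord0 j + e[}.
    by apply: cid; apply: rat_in_itvoo; rewrite ltrDl.
  exists (\row_j sval (lo j), \row_j sval (hi j)) => //.
  case: asboolP => [_ j|[]] /=.
    rewrite !mxE; case: (lo j) (hi j) => a /=; rewrite in_itv/=.
    by move=> /andP[_ ->] [b /=]; rewrite in_itv/= => /andP[->].
  move=> z /= zb; apply: eU; split => // i j; rewrite (ord1 i).
  move: (zb j); rewrite /= !mxE; case: (lo j) (hi j) => a /=; rewrite in_itv/=.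
  move=> /andP[ya _] [b /=]; rewrite in_itv/= => /andP[_ yb] /andP[az zb'].
  rewrite /ball/= /ball_ ltr_distlC; apply/andP; split.
    exact: lt_trans az.
  exact: lt_trans yb.
rewrite preimage_bigcup setI_bigcupr.
apply: countable_bigcupT_measurable => // q.
case: asboolP => _; last by rewrite preimage_set0 setI0.
(* The inner [D] gives each factor the form delivered by [mf]; the outer one keeps the identity true
   for [d = 0], where the intersection over [j] is the whole space. *)
have -> : D `&` f @^-1` box q = D `&` \bigcap_j
    (D `&` (fun t => f t ord0 j) @^-1` `]ratr (q.1 ord0 j), ratr (q.2 ord0 j)[).
  apply/seteqP; split=> t [Dt] tb; split=> // j.
    by move=> _; split=> //=; rewrite in_itv/=; exact: tb.
  by have [_] := tb j I; rewrite /= in_itv.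
apply: measurableI => //; apply: fin_bigcap_measurable => // j _.
by apply: mf.
Qed.

(** On nonnegative reals inversion is the power -1, with 0 sent to 0 on both sides, and real powers
    are measurable. *)
Lemma measurable_funV (R : realType) (disp : measure_display)
    (T : measurableType disp) (D : set T) (f : T -> R) :
  (forall t, 0 <= f t) -> measurable_fun D f ->
  measurable_fun D (fun t => (f t)^-1).
Proof.
move=> f0 mf.
under eq_fun do rewrite -powR_inv1//.
apply: (@measurableT_comp _ _ _ _ _ _ (fun x => powR x (-1))) => //.
Qed.

Lemma measurable_fun_sqrt (R : realType) (disp : measure_display)
    (T : measurableType disp) (D : set T) (f : T -> R) :
  measurable_fun D f -> measurable_fun D (fun t => Num.sqrt (f t)).
Proof.
apply: measurableT_comp.
by apply: continuous_measurable_fun; exact: sqrt_continuous.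
Qed.

Lemma measurable_coord (R : realType) (d : nat) (j : 'I_d) :
  measurable_fun setT (fun x : Rd R d => x ord0 j).
Proof.
apply: (measurability _ (RGenOpens.measurableE R)) => _ [_ [a [b ->]] <-].
rewrite setTI; apply: sub_sigma_algebra.
apply: open_comp => [x _|]; first exact: coord_continuous.
exact: interval_open.
Qed.

Lemma measurable_enorm (R : realType) (d : nat) :
  measurable_fun setT (@enorm R d : Rd R d -> R).
Proof.
apply: measurable_fun_sqrt; apply: measurable_sum => j.
by apply: measurable_funX; exact: measurable_coord.
Qed.

(** * Mixtures of image measures: from indicators to nonnegative functions *)

Section mixture.
Import HBNNSimple.
Context (d1 d2 d3 : measure_display) (T1 : measurableType d1)
  (T2 : measurableType d2) (T3 : measurableType d3) (R : realType).
Variables (m : {sigma_finite_measure set T2 -> \bar R}) (D : set T1).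
Hypothesis mD : measurable D.
Variables (w : T1 * T2 -> R) (P : T1 * T2 -> T3).
Hypotheses (w0 : forall z, 0 <= w z) (mw : measurable_fun setT w).
Hypothesis mP : measurable_fun setT P.

Let inner (h : T3 -> R) (x : T1) : \bar R :=
  (\int[m]_r (w (x, r) * h (P (x, r)))%:E)%E.

Let mixture (nu : {measure set T1 -> \bar R}) (h : T3 -> R) : \bar R :=
  (\int[nu]_(x in D) inner h x)%E.

Let measurable_integrand (h : T3 -> R) : measurable_fun setT h ->
  measurable_fun setT (fun z => (w z * h (P z))%:E).
Proof.
move=> mh; apply/measurable_EFinP; apply: measurable_funM => //.
exact: measurableT_comp.
Qed.

Let measurable_section (h : T3 -> R) (x : T1) : measurable_fun setT h ->
  measurable_fun setT (fun r => (w (x, r) * h (P (x, r)))%:E).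
Proof.
move=> mh; apply: (@measurableT_comp _ _ _ _ _ _
  (fun z => (w z * h (P z))%:E) _ (pair x)); first exact: measurable_integrand.
exact: pair1_measurable.
Qed.

(** Tonelli's theorem, for which [m] is sigma-finite. *)
Let measurable_inner (h : T3 -> R) : measurable_fun setT h ->
  (forall y, 0 <= h y) -> measurable_fun setT (inner h).
Proof.
move=> mh h0; apply: (measurable_fun_fubini_tonelli_F (fun z => (w z * h (P z))%:E)).
  exact: measurable_integrand.
by move=> z; rewrite lee_fin mulr_ge0.
Qed.

Let inner_ge0 (h : T3 -> R) x : (forall y, 0 <= h y) -> (0 <= inner h x)%E.
Proof. by move=> h0; apply: integral_ge0 => r _; rewrite lee_fin mulr_ge0. Qed.

(** Linearity of both integrals. The coefficients are values of [f], hence nonnegative, so sums and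
    scalars pass through integrals that may be infinite. *)
Let mixture_nnsfun nu (f : {nnsfun T3 >-> R}) : mixture nu f =
  (\sum_(i < #|` fset_set (range f)|) ((fset_set (range f))`_i)%:E *
     mixture nu \1_(f @^-1` [set (fset_set (range f))`_i]))%E.
Proof.
set s := fset_set (range f); have s0 (i : 'I_#|` s|) : 0 <= s`_i.
  have : s`_i \in s by exact: mem_nth.
  by rewrite in_fset_set// inE => -[y _ <-].
have mB i : measurable (f @^-1` [set s`_i]) by exact: measurable_funPTI.
pose B i : set T3 := f @^-1` [set s`_i].
have mI i : measurable_fun setT (\1_(B i) : T3 -> R).
  by apply: measurable_indic; exact: mB.
have I0 i y : 0 <= (\1_(B i) y : R) by rewrite indicE ler0n.
transitivity (\int[nu]_(x in D) \sum_(i < #|` s|) ((s`_i)%:E * inner \1_(B i) x))%E.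
  apply: eq_integral => x _.
  transitivity (\sum_(i < #|` s|)
      \int[m]_r ((s`_i)%:E * (w (x, r) * \1_(B i) (P (x, r)))%:E))%E; last first.
    apply: eq_bigr => i _; rewrite ge0_integralZl//.
    - exact: measurable_section.
    - by move=> r _; rewrite lee_fin mulr_ge0.
    - by rewrite lee_fin.
  rewrite -ge0_integral_sum//; last 2 first.
    by move=> i; apply: measurable_funeM; exact: measurable_section.
    by move=> i r _; rewrite mule_ge0// lee_fin// mulr_ge0.
  apply: eq_integral => r _.
  rewrite (fimfunEord f) mulr_sumr -sumEFin; apply: eq_bigr => i _.
  by rewrite -EFinM mulrCA.
rewrite ge0_integral_sum//; last 2 first.
  move=> i; apply: measurable_funeM; apply: measurable_funTS.
  exact: measurable_inner.
  by move=> i x _; rewrite mule_ge0// ?lee_fin//; exact: inner_ge0.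
apply: eq_bigr => i _; rewrite ge0_integralZl//.
- by apply: measurable_funTS; exact: measurable_inner.
- by move=> x _; exact: inner_ge0.
- by rewrite lee_fin.
Qed.

(** Monotone convergence applied twice, to the outer integral and then to the inner one, along
    simple functions increasing to [h]. *)
Let mixture_lim nu (h : T3 -> R) (mh : measurable_fun setT (EFin \o h)) :
  (forall y, 0 <= h y) ->
  mixture nu h = limn (fun n => mixture nu (nnsfun_approx measurableT mh n)).
Proof.
move=> h0; pose f := nnsfun_approx measurableT mh.
have h0' y : setT y -> (0 <= (EFin \o h) y)%E by rewrite /= lee_fin.
have nd_f y : {homo f ^~ y : a b / (a <= b)%N >-> a <= b}.
  by move=> a b ab; exact/lefP/nd_nnsfun_approx.
have nd_wf x r : {homo (fun n => (w (x, r) * f n (P (x, r)))%:E) :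
    a b / (a <= b)%N >-> (a <= b)%E}.
  by move=> a b ab; rewrite lee_fin ler_wpM2l// nd_f.
rewrite -monotone_convergence//; last 3 first.
- by move=> n; apply: measurable_funTS; apply: measurable_inner.
- by move=> n x _; exact: inner_ge0.
- move=> x _ a b ab; apply: ge0_le_integral => //.
  + by move=> r _; rewrite lee_fin mulr_ge0.
  + exact: measurable_section.
  + exact: measurable_section.
  + by move=> r _; exact: nd_wf.
apply: eq_integral => x _; rewrite -monotone_convergence//; last 2 first.
- by move=> n; exact: measurable_section.
- by move=> n r _; rewrite lee_fin mulr_ge0.
apply: eq_integral => r _; apply/esym/cvg_lim => //.
under eq_fun do rewrite EFinM.
rewrite EFinM; apply: cvgeZl => //.
exact: (cvg_nnsfun_approx _ _ h0').
Qed.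

(** Allows an unbounded weight to be tested against [A_op] when only its values on Borel sets are
    given. *)
Lemma eq_mixture (nu nu' : {measure set T1 -> \bar R}) :
  (forall B, measurable B ->
    \int[nu]_(x in D) \int[m]_r (w (x, r) * \1_B (P (x, r)))%:E =
    \int[nu']_(x in D) \int[m]_r (w (x, r) * \1_B (P (x, r)))%:E)%E ->
  forall h : T3 -> R, measurable_fun setT h -> (forall y, 0 <= h y) ->
  (\int[nu]_(x in D) \int[m]_r (w (x, r) * h (P (x, r)))%:E =
   \int[nu']_(x in D) \int[m]_r (w (x, r) * h (P (x, r)))%:E)%E.
Proof.
move=> eqB h mh h0; have mh' : measurable_fun setT (EFin \o h).
  exact/measurable_EFinP.
rewrite -/(mixture nu h) -/(mixture nu' h) !(mixture_lim _ _ mh')//.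
congr (limn _); apply/funext => n; rewrite !mixture_nnsfun.
apply: eq_bigr => i _; congr (_ * _)%E; apply: eqB.
exact: measurable_funPTI.
Qed.

End mixture.

(** * The Abel-type integral of the arcsine kernel *)

Section arcsine_integral.
Context {R : realType}.
Variables b s : R.
Hypotheses (b0 : 0 < b) (bs : b < s).

Let f (r : R) : R :=
  2 / pi * (Num.sqrt (s ^+ 2 - r ^+ 2))^-1 * (r / Num.sqrt (r ^+ 2 - b ^+ 2)).
(* [asin \o Q] is an antiderivative up to the factor [pi^-1] on ]b, s[, where [Q]
   is affine in [r ^+ 2] with values -1 at b and 1 at s; [rho] is the inverse of
   [asin \o Q].  As [asin] is not known to be continuous at -1 and 1, the
   integral is taken over [rho (- theta n), rho (theta n)] first. *)
Let Q (r : R) : R := (2 * r ^+ 2 - (s ^+ 2 + b ^+ 2)) / (s ^+ 2 - b ^+ 2).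
Let F (r : R) : R := pi^-1 * asin (Q r).
Let rho (t : R) : R :=
  Num.sqrt ((s ^+ 2 + b ^+ 2 + (s ^+ 2 - b ^+ 2) * sin t) / 2).
(** Increases to pi/2. With n + 2 in the denominator [theta 0] is already positive, so no interval
    of the exhaustion degenerates to a point. *)
Let theta (n : nat) : R := pi / 2 * (1 - n.+2%:R^-1).

Let D0 : 0 < s ^+ 2 - b ^+ 2.
Proof. by rewrite subr_gt0 ltr_sqr ?nnegrE ?ltW// (lt_trans b0). Qed.

Let s0 : 0 < s. Proof. exact: lt_trans bs. Qed.

Let Q_itv r : b < r < s -> -1 < Q r < 1.
Proof.
move=> /andP[br rs].
have r0 : 0 < r by exact: lt_trans br.
have r2 : b ^+ 2 < r ^+ 2 by rewrite ltr_sqr// nnegrE ltW.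
have r2' : r ^+ 2 < s ^+ 2 by rewrite ltr_sqr// nnegrE ltW.
by rewrite /Q ltr_pdivlMr// ltr_pdivrMr//; apply/andP; split; lra.
Qed.

Let Q_rho t : Q (rho t) = sin t.
Proof.
rewrite /Q /rho sqr_sqrtr; first by field; rewrite gt_eqF.
rewrite divr_ge0// (_ : _ + _ = (s ^+ 2 - b ^+ 2) * (1 + sin t) + 2 * b ^+ 2);
  last by ring.
by rewrite addr_ge0// mulr_ge0// ?sqr_ge0 ?ltW// -lerBlDl sub0r sin_geN1.
Qed.

Let rho_Q r : b < r -> r = rho (asin (Q r)) \/ s <= r.
Proof.
move=> br; have [rs|] := ltP r s; [left|by right].
have /andP[Q1 Q2] := Q_itv r (introT andP (conj br rs)).
rewrite /rho asinK ?in_itv/= ?ltW//.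
rewrite (_ : _ / 2 = r ^+ 2); last by rewrite /Q; field; rewrite gt_eqF.
by rewrite sqrtr_sqr ger0_norm// ltW// (lt_trans b0).
Qed.

Let le_rho t u : - (pi / 2) <= t -> t <= u -> u <= pi / 2 -> rho t <= rho u.
Proof.
move=> t1 tu u1; rewrite ler_wsqrtr// ler_pM2r// lerD2l ler_pM2l//.
move: tu; rewrite le_eqVlt => /predU1P[->//|tu]; apply/ltW.
rewrite ltr_sin// in_itv/=; apply/andP; split => //; apply: ltW.
  exact: lt_le_trans tu u1.
exact: le_lt_trans t1 tu.
Qed.

Let rho_itv t : - (pi / 2) < t < pi / 2 -> b < rho t < s.
Proof.
move=> /andP[t1 t2].
have h1 : -1 < sin t.
  by rewrite -(sin_pihalf R) -sinN ltr_sin// in_itv/= ?lexx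
    ?(ltW t1) ?(ltW t2) ?(ltW (lt_trans t1 t2)).
have h2 : sin t < 1.
  by rewrite -(sin_pihalf R) ltr_sin// in_itv/= ?lexx
    ?(ltW t1) ?(ltW t2) ?(ltW (lt_trans t1 t2)).
have Dp : 0 < (s ^+ 2 - b ^+ 2) * (sin t + 1).
  by rewrite mulr_gt0// -ltrBlDr sub0r.
have Dm : 0 < (s ^+ 2 - b ^+ 2) * (1 - sin t) by rewrite mulr_gt0// subr_gt0.
rewrite /rho -[X in X < _ < _](ger0_norm (ltW b0)) -[X in _ < _ < X](ger0_norm (ltW s0)).
rewrite -!sqrtr_sqr; apply/andP; split; rewrite ltr_sqrt.
- by lra.
- by have := sqr_ge0 b; lra.
- by lra.
- by rewrite exprn_gt0.
Qed.

Let dF r : b < r < s -> is_derive r 1 F (f r).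
Proof.
move=> /[dup] brs /andP[br rs].
have r0 : 0 < r by exact: lt_trans br.
have r2 : b ^+ 2 < r ^+ 2 by rewrite ltr_sqr// nnegrE ltW.
have r2' : r ^+ 2 < s ^+ 2 by rewrite ltr_sqr// nnegrE ltW.
have Qd : is_derive r 1 Q (4 * r / (s ^+ 2 - b ^+ 2)).
  have -> : Q = (2 / (s ^+ 2 - b ^+ 2)) \*: (@id R ^+ 2) -
      cst ((s ^+ 2 + b ^+ 2) / (s ^+ 2 - b ^+ 2)).
    apply/funext => x; rewrite /Q -[RHS]/(2 / (s ^+ 2 - b ^+ 2) * x ^+ 2 -
      (s ^+ 2 + b ^+ 2) / (s ^+ 2 - b ^+ 2)).
    by field; rewrite gt_eqF.
  apply: is_derive_eq; rewrite /= /GRing.scale /=.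
  by field; rewrite gt_eqF.
(* 1 - Q = 2 (s^2 - r^2) / (s^2 - b^2) and 1 + Q = 2 (r^2 - b^2) / (s^2 - b^2), so the derivative of
   [asin] produces both square roots of [f]. *)
have sQ : Num.sqrt (1 - Q r ^+ 2) =
    2 * (Num.sqrt (s ^+ 2 - r ^+ 2) * Num.sqrt (r ^+ 2 - b ^+ 2)) /
    (s ^+ 2 - b ^+ 2).
  have -> : 1 - Q r ^+ 2 = (2 * (Num.sqrt (s ^+ 2 - r ^+ 2) *
      Num.sqrt (r ^+ 2 - b ^+ 2)) / (s ^+ 2 - b ^+ 2)) ^+ 2.
    rewrite !exprMn !sqr_sqrtr ?subr_ge0 ?(ltW r2) ?(ltW r2')//.
    by rewrite /Q; field; rewrite gt_eqF.
  by rewrite sqrtr_sqr ger0_norm// divr_ge0 ?(ltW D0).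
apply: (is_derive_eq (is_deriveZ pi^-1
  (is_derive1_comp (is_derive1_asin (Q_itv r brs)) Qd))).
rewrite sQ /f /GRing.scale /=; move: (@pi R) (@pi_gt0 R) => p p0; field.
by rewrite !gt_eqF ?sqrtr_gt0 ?D0 ?subr_gt0.
Qed.

Let cF r : b < r < s -> {for r, continuous F}.
Proof.
move=> brs; have [dFr _] := dF r brs.
exact/differentiable_continuous/derivable1_diffP.
Qed.

Let cf r : b < r < s -> {for r, continuous f}.
Proof.
move=> /andP[br rs].
have r0 : 0 < r by exact: lt_trans br.
have r2 : b ^+ 2 < r ^+ 2 by rewrite ltr_sqr// nnegrE ltW.
have r2' : r ^+ 2 < s ^+ 2 by rewrite ltr_sqr// nnegrE ltW.
have csq (u : R -> R) : {for r, continuous u} ->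
    {for r, continuous (fun x => Num.sqrt (u x))}.
  by move=> cu; apply: continuous_comp => //; exact: sqrt_continuous.
have c2 : {for r, continuous (fun x : R => x ^+ 2)} by exact: exprn_continuous.
apply: cvgM.
  apply: cvgM; first exact: cvg_cst.
  apply: cvgV; first by rewrite gt_eqF// sqrtr_gt0 subr_gt0.
  by apply: csq; apply: cvgB => //; exact: cvg_cst.
apply: cvgM; first exact: cvg_id.
apply: cvgV; first by rewrite gt_eqF// sqrtr_gt0 subr_gt0.
by apply: csq; apply: cvgB => //; exact: cvg_cst.
Qed.

Let theta_gt0 n : 0 < theta n.
Proof.
rewrite mulr_gt0// ?divr_gt0 ?pi_gt0// subr_gt0 invf_lt1// ltr1n//.
Qed.

Let theta_lt n : theta n < pi / 2.
Proof.
by rewrite -[ltRHS]mulr1 ltr_pM2l ?divr_gt0 ?pi_gt0// ltrBlDr ltrDl invr_gt0.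
Qed.

Let theta_itv n : - (pi / 2) < theta n < pi / 2.
Proof.
by rewrite theta_lt andbT (lt_trans _ (theta_gt0 n))// oppr_lt0 divr_gt0 ?pi_gt0.
Qed.

Let thetaN_itv n : - (pi / 2) < - theta n < pi / 2.
Proof. by have /andP[? ?] := theta_itv n; rewrite ltrN2 ltrNl theta_lt. Qed.

Let rho_lt n : rho (- theta n) < rho (theta n).
Proof.
rewrite lt_neqAle; apply/andP; split.
  (* Equal endpoints would give sin (theta n) = - sin (theta n), whereas 0 < theta n < pi. *)
  apply/eqP => /(congr1 Q); rewrite !Q_rho sinN => /eqP; rewrite eq_sym.
  rewrite -addr_eq0 -mulr2n mulrn_eq0/= gt_eqF// sin_gt0_pi//.
  rewrite theta_gt0 (lt_trans (theta_lt n))// ltr_pdivrMr//.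
  by rewrite ltr_pMr ?pi_gt0// ltr1n.
have /andP[a1 _] := thetaN_itv n; rewrite le_rho ?(ltW a1) ?ltW//.
by rewrite ltrNl (lt_trans _ (theta_gt0 n)) ?oppr_lt0.
Qed.

(** By the fundamental theorem of calculus the value is (theta n - (- theta n)) / pi. *)
Let integral_rho n :
  (\int[lebesgue_measure]_(r in `[rho (- theta n), rho (theta n)]) (f r)%:E =
    (1 - n.+2%:R^-1)%:E)%E.
Proof.
have /andP[a1 a2] := rho_itv _ (thetaN_itv n).
have /andP[c1 c2] := rho_itv _ (theta_itv n).
have sub r : rho (- theta n) <= r <= rho (theta n) -> b < r < s.
  by move=> /andP[h1 h2]; rewrite (lt_le_trans a1 h1) (le_lt_trans h2 c2).
rewrite (@continuous_FTC2 _ f F)//.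
- have /andP[t1 t2] := theta_itv n; have /andP[u1 u2] := thetaN_itv n.
  rewrite /F !Q_rho !sinK ?in_itv/= ?ltW//.
  rewrite -EFinB; congr EFin; rewrite /theta.
  move: (1 - _) (@pi R) (@pi_gt0 R) => c p p0; field.
  by rewrite gt_eqF.
- apply: continuous_in_subspaceT => r /[!inE]/=; rewrite in_itv/= => /sub.
  exact: cf.
- split.
  + move=> r; rewrite in_itv/= => /andP[h1 h2].
    by have [] := dF r (sub r _); rewrite ?ltW.
  + by apply: cvg_at_right_filter; apply: cF; rewrite a1.
  + by apply: cvg_at_left_filter; apply: cF; rewrite c1.
- move=> r; rewrite in_itv/= => /andP[h1 h2]; rewrite derive1E.
  by have [] := dF r (sub r _); rewrite ?ltW.
Qed.

Let mf : measurable_fun setT f.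
Proof.
apply: measurable_funM; first apply: measurable_funM => //.
- apply: measurable_funV => [r|]; first exact: sqrtr_ge0.
  by apply: measurable_fun_sqrt; apply: measurable_funB.
- apply: measurable_funM => //.
  apply: measurable_funV => [r|]; first exact: sqrtr_ge0.
  by apply: measurable_fun_sqrt; apply: measurable_funB.
Qed.

Let bigcup_rho :
  \bigcup_n `[rho (- theta n), rho (theta n)]%classic = `]b, s[%classic.
Proof.
apply/seteqP; split => [r [n _]|r]; rewrite /= !in_itv/=.
  move=> /andP[h1 h2]; have /andP[a1 a2] := rho_itv _ (thetaN_itv n).
  have /andP[c1 c2] := rho_itv _ (theta_itv n).
  by rewrite (lt_le_trans a1 h1) (le_lt_trans h2 c2).
move=> /[dup] brs /andP[br rs].
have [rE|] := rho_Q r br; last by rewrite leNgt rs.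
have /andP[Q1 Q2] := Q_itv r brs; set u := asin (Q r) in rE.
have u2 : u < pi / 2 by rewrite asin_ltpi2// ltW.
have u1 : - (pi / 2) < u by rewrite asin_gtNpi2// Q1 ltW.
have pi20 : 0 < pi / 2 :> R by rewrite divr_gt0 ?pi_gt0.
(* The bound |u| <= theta n amounts to 1/(n+2) <= 1 - |u| / (pi/2), whose right-hand side is
   positive; an n with 1/(n+1) below it is enough. *)
have e0 : 0 < 1 - `|u| / (pi / 2).
  by rewrite subr_gt0 ltr_pdivrMr// mul1r ltr_norml u1.
have [n _ /(_ n (leqnn n)) nP] := near_infty_natSinv_lt (PosNum e0).
have un : `|u| <= theta n.
  rewrite /theta mulrC -ler_pdivrMr// lerBrDl -lerBrDr ltW// (le_lt_trans _ nP)//.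
  by rewrite lef_pV2 ?posrE// ler_nat.
move: un; rewrite ler_norml => /andP[un1 un2].
exists n => //; rewrite /= in_itv/= rE.
have /andP[a1 a2] := thetaN_itv n; have /andP[c1 c2] := theta_itv n.
by rewrite !le_rho// ltW.
Qed.

(** The compact intervals of [bigcup_rho] increase to ]b, s[, and their integrals 1 - 1/(n+2) tend
    to 1. *)
Lemma arcsine_integral :
  (\int[lebesgue_measure]_(r in `]b, s[) (f r)%:E = 1)%E.
Proof.
rewrite -bigcup_rho.
have f0 n r : [set` `[rho (- theta n), rho (theta n)]] r -> (0 <= (f r)%:E)%E.
  rewrite /= in_itv/= => /andP[h _].
  have /andP[a1 _] := rho_itv _ (thetaN_itv n).
  have r0 : 0 <= r by rewrite (le_trans _ h)// (le_trans (ltW b0))// ltW.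
  by rewrite lee_fin !mulr_ge0 ?invr_ge0 ?sqrtr_ge0// pi_ge0.
have nd : nondecreasing_seq (fun n => [set` `[rho (- theta n), rho (theta n)]]).
  move=> n k nk; apply/subsetPset => r; rewrite /= !in_itv/= => /andP[h1 h2].
  have nk' : theta n <= theta k.
    rewrite ler_pM2l ?divr_gt0 ?pi_gt0// lerD2l lerN2.
    by rewrite lef_pV2 ?posrE// ler_nat.
  have /andP[a1 _] := thetaN_itv k; have /andP[_ c2] := theta_itv k.
  have /andP[a1' a2'] := thetaN_itv n; have /andP[c1' c2'] := theta_itv n.
  rewrite (le_trans _ h1) ?le_rho ?(ltW a1) ?lerN2 ?(ltW a2')//=.
  by rewrite (le_trans h2)// le_rho ?(ltW c1') ?(ltW c2).
have := @ge0_nondecreasing_set_cvg_integral _ (measurableTypeR R) R _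
  (fun r => (f r)%:E) (@lebesgue_measure R) nd (fun=> measurable_itv _)
  (fun=> measurable_funTS ((measurable_EFinP _ _).2 mf)) f0.
under eq_fun do rewrite integral_rho.
move=> /(cvg_lim (@ereal_hausdorff _)) <-; apply/cvg_lim => //.
apply: cvg_EFin; first by near=> n.
rewrite -[X in _ --> X]subr0; apply: cvgB; first exact: cvg_cst.
(* 1/(n+2) is the harmonic sequence 1/(n+1) shifted by one. *)
have := @cvg_harmonic R; rewrite -cvg_shiftS; exact.
Unshelve. all: by end_near. Qed.

End arcsine_integral.

(** * Polar coordinates and the conical sets generating the Borel sets *)

Section polar.
Context {R : realType} {d : nat}.
Implicit Types (x : Rd R d) (C : set (Rd R d)).

Lemma enorm_ge0 x : 0 <= enorm x.
Proof. exact: sqrtr_ge0. Qed.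

Lemma enorm_eq0 x : (enorm x == 0) = (x == 0).
Proof.
rewrite sqrtr_eq0; apply/idP/eqP => [|->]; last first.
  by rewrite big1// => i _; rewrite mxE expr0n.
move=> s0; apply/rowP => i; rewrite mxE; apply/eqP; rewrite -sqrf_eq0.
have : \sum_(i < d) x ord0 i ^+ 2 == 0.
  by rewrite eq_le s0 sumr_ge0// => j _; exact: sqr_ge0.
rewrite psumr_eq0 => [/allP/(_ i)|j _]; last exact: sqr_ge0.
by rewrite mem_index_enum => /(_ isT).
Qed.

Lemma enormZ (a : R) x : 0 <= a -> enorm (a *: x) = a * enorm x.
Proof.
move=> a0; rewrite /enorm -{2}(ger0_norm a0) -sqrtr_sqr -sqrtrM ?sqr_ge0//.
by rewrite mulr_sumr; congr Num.sqrt; apply: eq_bigr => i _; rewrite mxE exprMn.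
Qed.

Definition direction x : Rd R d := (enorm x)^-1 *: (x : 'rV[R]_d).

Lemma direction0 : direction 0 = 0. Proof. exact: scaler0. Qed.

Lemma scale_direction x : enorm x *: (direction x : 'rV[R]_d) = x.
Proof.
have [->|x0] := eqVneq x 0; first by rewrite direction0 scaler0.
by rewrite scalerA divff ?scale1r// enorm_eq0.
Qed.

Definition cone_tail (c : R) C : set (Rd R d) :=
  [set x | c < enorm x /\ C (direction x)].

Lemma measurable_direction : measurable_fun setT direction.
Proof.
apply: measurable_funRd => j; under eq_fun do rewrite mxE.
apply: measurable_funM; last exact: measurable_coord.
by apply: measurable_funV; [exact: enorm_ge0|exact: measurable_enorm].
Qed.

Lemma measurable_cone_tail c C : measurable C -> measurable (cone_tail c C).
Proof.
move=> mC; have -> : cone_tail c C =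
    (setT `&` (@enorm R d) @^-1` `]c, +oo[) `&` (setT `&` direction @^-1` C).
  apply/seteqP; split => x /=; rewrite in_itv/= andbT => -[] //.
  by move=> [_ ?] [_ ?].
apply: measurableI; first by apply: measurable_enorm => //; exact: measurable_itv.
exact: measurable_direction.
Qed.

Lemma measurable_origin : measurable ([set 0] : set (Rd R d)).
Proof.
rewrite (_ : [set 0] = setT `&` (@enorm R d) @^-1` [set 0]).
  by apply: measurable_enorm.
rewrite setTI; apply/seteqP; split => x /= /eqP.
  by rewrite -enorm_eq0 => /eqP.
by rewrite enorm_eq0 => /eqP.
Qed.

(** The origin is a generator of its own because a conical set with [0 < c] misses it. *)
Let G : set (set (Rd R d)) := [set A | A = [set 0] \/
  exists c, 0 < c /\ exists C, measurable C /\ A = cone_tail c C].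

Let cone_tail_neq0 c C x : 0 < c -> cone_tail c C x -> x != 0.
Proof. by move=> c0 [cx _]; rewrite -enorm_eq0 gt_eqF// (lt_trans c0). Qed.

Let bigcup_cone_tail C :
  \bigcup_n cone_tail n.+1%:R^-1 C = [set x | x != 0 /\ C (direction x)].
Proof.
apply/seteqP; split => x /=.
  move=> [n _ nx]; split; last by have [] := nx.
  exact: cone_tail_neq0 nx.
move=> [x0 Cx]; have xp : 0 < enorm x.
  by rewrite lt_neqAle enorm_ge0 eq_sym enorm_eq0 x0.
have [n _ /(_ n (leqnn n)) nP] := near_infty_natSinv_lt (PosNum xp).
by exists n.
Qed.

Let GI : setI_closed G.
Proof.
(* The empty set is the cone over no direction; it arises as the intersection of the origin with a
   cone. *)
have G0 : G set0.
  right; exists 1; split => //; exists set0; split => //.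
  by apply/seteqP; split => x // -[].
have disj c C : 0 < c -> [set 0] `&` cone_tail c C = set0.
  move=> c0; apply/seteqP; split => x //= [->].
  by move=> /(cone_tail_neq0 _ _ _ c0); rewrite eqxx.
move=> A B [->|[c [c0 [C [mC ->]]]]] [->|[e [e0 [E [mE ->]]]]].
- by left; rewrite setIid.
- by rewrite disj.
- by rewrite setIC disj.
- right; exists (Num.max c e); split; first by rewrite lt_max c0.
  exists (C `&` E); split; first exact: measurableI.
  apply/seteqP; split => x /=.
    by move=> [[cx Cx] [ex Ex]]; split => //; rewrite gt_max cx.
  by rewrite /cone_tail/= gt_max => -[/andP[? ?] [? ?]].
Qed.

(** The same points with the sigma-algebra generated by [G]. Borel sets belong to it once the
    identity from [T] to [Rd R d] is measurable. *)
Let T := g_sigma_algebraType G.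

Let mG0 : measurable ([set 0] : set T).
Proof. by apply: sub_sigma_algebra; left. Qed.

Let mG_cone (c : R) C : 0 < c -> measurable C -> measurable (cone_tail c C : set T).
Proof.
by move=> c0 mC; apply: sub_sigma_algebra; right; exists c; split => //; exists C.
Qed.

Let mG_direction : measurable_fun setT (direction : T -> Rd R d).
Proof.
move=> _ C mC; rewrite setTI.
(* Off the origin, the preimage is the union of the cones over [C] with thresholds 1/(n+1); the
   origin belongs to it exactly when 0 is in [C], as [direction 0 = 0]. *)
have -> : direction @^-1` C = (\bigcup_n cone_tail n.+1%:R^-1 C) `|`
    (if `[<C 0>] then [set 0] else set0).
  rewrite bigcup_cone_tail; apply/seteqP; split => x /=.
    have [->|x0 Cx] := eqVneq x 0; last by left.
    by rewrite direction0 => C0; right; case: asboolP.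
  by move=> [[]//|]; case: asboolP => //= C0 ->; rewrite direction0.
apply: measurableU; last by case: ifP.
by apply: bigcupT_measurable => n; exact: mG_cone.
Qed.

Let mG_enorm : measurable_fun setT (@enorm R d : T -> R).
Proof.
apply: (measurability _ (RGenOInfty.measurableE R)) => _ [_ [a ->] <-].
rewrite setTI.
have [a0|a0|->] := ltgtP a 0.
- rewrite (_ : _ @^-1` _ = setT)//; apply/seteqP; split => x //= _.
  by rewrite in_itv/= andbT (lt_le_trans a0)// enorm_ge0.
- rewrite (_ : _ @^-1` _ = cone_tail a setT); first exact: mG_cone.
  by apply/seteqP; split => x /=; rewrite in_itv/= andbT // => -[].
- rewrite (_ : _ @^-1` _ = ~` [set 0]); first exact: measurableC.
  apply/seteqP; split => x /=; rewrite in_itv/= andbT.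
    by move=> + x0; rewrite x0 lt_neqAle eq_sym enorm_eq0 eqxx.
  by move=> /eqP x0; rewrite lt_neqAle enorm_ge0 eq_sym enorm_eq0 x0.
Qed.

Let measurableG : @measurable _ (Rd R d) = <<s G >>.
Proof.
apply/seteqP; split => [A mA|].
  (* Since x = |x| * direction x, each coordinate is a product of two functions already measurable
     on [T]. *)
  have mid : measurable_fun setT (id : T -> Rd R d).
    apply: measurable_funRd => j.
    rewrite (_ : (fun _ => _) =
        fun x : T => enorm x * direction x ord0 j); last first.
      by apply/funext => x; rewrite -[in LHS](scale_direction x) mxE.
    apply: measurable_funM => //.
    apply: (@measurableT_comp _ _ _ _ _ _ (fun x : Rd R d => x ord0 j)) => //.
    exact: measurable_coord.
  by have := mid measurableT A mA; rewrite setTI.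
apply: smallest_sub; first exact: sigma_algebra_measurable.
move=> A [->|[c [c0 [C [mC ->]]]]]; first exact: measurable_origin.
exact: measurable_cone_tail.
Qed.

Lemma cone_tail_measure_unique (nu nu' : {measure set (Rd R d) -> \bar R}) :
  nu [set 0] = 0%E -> nu' [set 0] = 0%E ->
  (forall c, 0 < c -> (nu (cone_tail c setT) < +oo)%E) ->
  (forall c C, 0 < c -> measurable C ->
    nu (cone_tail c C) = nu' (cone_tail c C)) ->
  forall B, measurable B -> nu B = nu' B.
Proof.
move=> nu0 nu'0 fin eqc B mB.
(* A countable cover by members of [G] of finite mass: index 0 is the origin, index n' + 1 is the
   set |x| > 1/(n'+1). *)
pose g n : set (Rd R d) :=
  if n is n'.+1 then cone_tail n'.+1%:R^-1 setT else [set 0].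
apply: (measure_unique G g) => //.
- by move=> [|n]; [left|right; exists n.+1%:R^-1; split => //; exists setT].
- apply/seteqP; split => x // _; have [->|x0] := eqVneq x 0; first by exists 0%N.
  have : [set x | x != 0 /\ setT (direction x)] x by [].
  by rewrite -bigcup_cone_tail => -[n _ nx]; exists n.+1.
- by move=> A [->|[c [c0 [C [mC ->]]]]]; [rewrite nu0 nu'0|exact: eqc].
- by move=> [|n]; [rewrite /= nu0|exact: fin].
Qed.

End polar.

(** * The two kernels as one arcsine kernel with right endpoint [kern_radius k s] *)

Definition kern_radius {R : realType} (k : nat) (s : R) : R :=
  if k == 1%N then Num.sqrt s else s.

Lemma kern_radius_gt0 (R : realType) k (s : R) : 0 < s -> 0 < kern_radius k s.
Proof. by rewrite /kern_radius; case: ifP => //; rewrite sqrtr_gt0. Qed.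

(** Translates the condition b < t on kernel endpoints into the threshold on |x| that defines a
    conical set. *)
Lemma ltr_kern_radius (R : realType) k (c s : R) : 0 < c ->
  (kern_radius k c < kern_radius k s) = (c < s).
Proof.
move=> c0; rewrite /kern_radius; case: ifP => // _.
by rewrite !ltNge ler_sqrt ?(ltW c0).
Qed.

(* No case [r >= kern_radius k s] is needed: the square root of a nonpositive
   number and the inverse of 0 are both 0. *)
Lemma a_kernE (R : realType) k (r s : R) : 0 <= s ->
  a_kern k r s = if 0 < r
    then 2 / pi * (Num.sqrt (kern_radius k s ^+ 2 - r ^+ 2))^-1 else 0.
Proof.
move=> s0; rewrite /a_kern /kern_radius.
have sqrt0 (u : R) : 0 <= u -> u <= r -> Num.sqrt (u ^+ 2 - r ^+ 2) = 0.
  by move=> u0 ur; rewrite ler0_sqrtr// subr_le0 ler_sqr ?nnegrE// (le_trans u0).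
case: ifP => _; case: (ltP 0 r) => //= r0; case: ltP => // sr.
- by rewrite sqr_sqrtr.
- by rewrite sqrt0// ?sqrtr_ge0// invr0 mulr0.
- by rewrite sqrt0// invr0 mulr0.
Qed.

Lemma a_kern_ge0 (R : realType) k (r s : R) : 0 <= s -> 0 <= a_kern k r s.
Proof.
move=> s0; rewrite a_kernE//; case: ifP => // _.
by rewrite mulr_ge0 ?invr_ge0 ?sqrtr_ge0// divr_ge0// pi_ge0.
Qed.

(** * Recovering the mass of conical sets from [A_op] *)

Section inversion.
Context {R : realType} {d : nat}.
Variable k : nat.
Implicit Types (x : Rd R d) (C : set (Rd R d))
  (nu : {measure set (Rd R d) -> \bar R}).

Let w (z : Rd R d * measurableTypeR R) : R := a_kern k z.2 (enorm z.1).
Let P (z : Rd R d * measurableTypeR R) : Rd R d :=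
  (z.2 / enorm z.1) *: (z.1 : 'rV[R]_d).

Let menorm1 : measurable_fun setT
  (fun z : Rd R d * measurableTypeR R => enorm z.1 : R).
Proof. by apply: measurableT_comp => //; exact: measurable_enorm. Qed.

Let mw : measurable_fun setT w.
Proof.
rewrite /w; under eq_fun do rewrite a_kernE ?enorm_ge0//.
apply: measurable_fun_ifT => //; first exact: measurable_fun_ltr.
apply: measurable_funM => //; apply: measurable_funV => [z|]; first exact: sqrtr_ge0.
apply: measurable_fun_sqrt; apply: measurable_funB; apply: measurable_funX => //.
rewrite /kern_radius; case: (k == 1%N) => //.
exact: measurable_fun_sqrt.
Qed.

Let mP : measurable_fun setT P.
Proof.
apply: measurable_funRd => j; rewrite /P; under eq_fun do rewrite mxE.
apply: measurable_funM.
  apply: measurable_funM => //.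
  by apply: measurable_funV => // z; exact: enorm_ge0.
apply: (@measurableT_comp _ _ _ _ _ _ (fun x : Rd R d => x ord0 j)) => //.
exact: measurable_coord.
Qed.

(** The kernel vanishes for r <= 0, so the inner integral extends to the whole line, the shape that
    [eq_mixture] expects. *)
Lemma A_opE nu B : A_op k nu B =
  (\int[nu]_(x in [set~ 0%R]) \int[@lebesgue_measure R]_r
    (w (x, r) * \1_B (P (x, r)))%:E)%E.
Proof.
apply: eq_integral => x _; rewrite integral_mkcond/=.
apply: eq_integral => r _; rewrite patchE; case: ifPn => // /negP r0.
rewrite /w /= a_kernE ?enorm_ge0//; case: ifP => [rp|_]; last by rewrite mul0r.
by exfalso; apply: r0; rewrite inE/= in_itv/= ltW.
Qed.

(* The Abel-type weight on the ray: [r / sqrt (r^2 - b^2)], which vanishes for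
   [r <= b] since then the square root is 0. *)
Let h (b : R) C (y : Rd R d) : R :=
  enorm y / Num.sqrt (enorm y ^+ 2 - b ^+ 2) * \1_C (direction y).

Let h_ge0 b C y : 0 <= h b C y.
Proof. by rewrite !mulr_ge0 ?invr_ge0 ?sqrtr_ge0 ?enorm_ge0 ?indicE ?ler0n. Qed.

Let mh b C : measurable C -> measurable_fun setT (h b C).
Proof.
move=> mC; have me := @measurable_enorm R d; apply: measurable_funM.
  apply: measurable_funM => //; apply: measurable_funV => [z|].
    exact: sqrtr_ge0.
  by apply: measurable_fun_sqrt; apply: measurable_funB => //; apply: measurable_funX.
apply: (@measurableT_comp _ _ _ _ _ _ (\1_C : Rd R d -> R)).
  exact: measurable_indic.
exact: measurable_direction.
Qed.

(** For r > 0 the point [P (x, r)] has norm r and the direction of [x], so the indicator of [C] is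
    constant along the ray and [arcsine_integral] applies when b < s. *)
Let integral_h c C x : 0 < c -> x != 0 ->
  (\int[@lebesgue_measure R]_r (w (x, r) * h (kern_radius k c) C (P (x, r)))%:E =
   (\1_(cone_tail c C) x)%:E)%E.
Proof.
move=> c0 x0; have xp : 0 < enorm x.
  by rewrite lt_neqAle enorm_ge0 eq_sym enorm_eq0 x0.
set b := kern_radius k c; set s := kern_radius k (enorm x).
have b0 : 0 < b by exact: kern_radius_gt0.
have s0 : 0 < s by exact: kern_radius_gt0.
pose f r := 2 / pi * (Num.sqrt (s ^+ 2 - r ^+ 2))^-1 *
  (r / Num.sqrt (r ^+ 2 - b ^+ 2)).
have sqrt0 (u v : R) : 0 < u -> u <= v -> Num.sqrt (u ^+ 2 - v ^+ 2) = 0.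
  move=> u0 ur; rewrite ler0_sqrtr// subr_le0 ler_sqr ?nnegrE//; first exact: ltW.
  by rewrite (le_trans _ ur)// ltW.
(* Outside ]b, s[ the integrand is 0: for r <= 0 the kernel is, and for 0 < r <= b or r >= s one of
   the square roots is 0, with inverse 0. *)
transitivity (\int[@lebesgue_measure R]_(r in `]b, s[)
    (f r * \1_C (direction x))%:E)%E.
  rewrite [RHS]integral_mkcond; apply: eq_integral => r _.
  rewrite patchE /w /= a_kernE ?enorm_ge0// -/s.
  have [r0|r0] := ltP 0 r; last first.
    rewrite mul0r; case: ifPn => //; rewrite inE/= in_itv/= => /andP[br _].
    by have := lt_le_trans br r0; rewrite ltNge ltW.
  have Pn : enorm (P (x, r)) = r.
    by rewrite /P /= enormZ ?divr_ge0 ?enorm_ge0 ?ltW// divfK// gt_eqF.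
  have Pd : direction (P (x, r)) = direction x.
    rewrite /direction Pn /P/= scalerA; congr (_ *: _).
    by rewrite mulrA mulVf ?mul1r// gt_eqF.
  rewrite /h Pn Pd mulrA -/(f r); case: ifPn => //.
  move=> /negP rbs; suff -> : f r = 0 by rewrite mul0r.
  rewrite /f; have [br|rb] := ltP b r; last by rewrite (sqrt0 r b)// invr0 !mulr0.
  have [rs|sr] := ltP r s; last by rewrite (sqrt0 s r)// invr0 mulr0 mul0r.
  by exfalso; apply: rbs; rewrite inE/= in_itv/= br.
have bsE : (b < s) = (c < enorm x) by exact: ltr_kern_radius.
have [bs|sb] := ltP b s; last first.
  rewrite set_itv_ge ?integral_set0 -?leNgt//.
  by rewrite indicE memNset// => -[]; rewrite -bsE ltNge sb.
have [Cx|nCx] := pselect (C (direction x)).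
  rewrite (_ : \1_(cone_tail c C) x = 1); last first.
    by rewrite indicE mem_set// /cone_tail/= -bsE.
  under eq_integral do rewrite indicE mem_set// mulr1.
  exact: arcsine_integral.
rewrite (_ : \1_(cone_tail c C) x = 0); last by rewrite indicE memNset// => -[].
under eq_integral do rewrite indicE memNset// mulr0.
exact: integral0.
Qed.

Lemma A_op_cone_tail nu nu' c C : nu [set 0%R] = 0%E -> nu' [set 0%R] = 0%E ->
  (forall B, measurable B -> A_op k nu B = A_op k nu' B) ->
  0 < c -> measurable C -> nu (cone_tail c C) = nu' (cone_tail c C).
Proof.
move=> nu0 nu'0 eqA c0 mC.
have mD : measurable ([set~ 0] : set (Rd R d)).
  by apply: measurableC; exact: measurable_origin.
(* The mass of the cone is a mixture of [h], by the same formula for [nu] and [nu']; [eq_mixture]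
   then compares the two. *)
suff E (m : {measure set (Rd R d) -> \bar R}) : m [set 0%R] = 0%E ->
    m (cone_tail c C) = (\int[m]_(x in [set~ 0%R]) \int[@lebesgue_measure R]_r
      (w (x, r) * h (kern_radius k c) C (P (x, r)))%:E)%E.
  rewrite !E//.
  apply: (eq_mixture _ _ _ _ _ _ R (@lebesgue_measure R) _ mD w P) => //.
  - by move=> z; apply: a_kern_ge0; exact: enorm_ge0.
  - by move=> B mB; rewrite -!A_opE eqA.
  - exact: mh.
move=> m0; transitivity (\int[m]_(x in [set~ 0%R]) (\1_(cone_tail c C) x)%:E)%E.
  rewrite integral_indic//; last exact: measurable_cone_tail.
  congr (m _); apply/seteqP; split => x //= => [[cx Cx]|[]//]; split => // x0.
  move: cx; rewrite (_ : enorm x = 0) ?ltNge ?(ltW c0)//.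
  by apply/eqP; rewrite enorm_eq0 x0.
by apply: eq_integral => x; rewrite inE/= => /eqP x0; rewrite integral_h.
Qed.

(** Markov's inequality: on the set |x| > c the integrand min(1, |x|^k) is at least the positive
    constant min(1, c^k). *)
Lemma levy_cone_tail nu c : levy_measure k nu -> 0 < c ->
  (nu (cone_tail c setT) < +oo)%E.
Proof.
move=> [_ nufin] c0; have mc := measurable_cone_tail c setT measurableT.
pose e : R := Num.min 1 (c ^+ k).
have e0 : 0 < e by rewrite lt_min ltr01 exprn_gt0.
have m1 : measurable_fun setT (fun x : Rd R d => (Num.min 1 (enorm x ^+ k))%:E).
  apply/measurable_EFinP; apply: measurable_minr => //.
  by apply: measurable_funX; exact: measurable_enorm.
have : (e%:E * nu (cone_tail c setT) < +oo)%E.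
  apply: le_lt_trans nufin; rewrite -(setIT (cone_tail _ _)) -integral_indic//.
  rewrite -ge0_integralZl//; last 2 first.
  - by apply/measurable_EFinP; exact: measurable_indic.
  - by rewrite lee_fin ltW.
  apply: ge0_le_integral => //.
  - by move=> x _; rewrite -EFinM lee_fin mulr_ge0// ltW.
  - apply/measurable_EFinP/measurable_funM => //; exact: measurable_indic.
  - move=> x _; rewrite -EFinM lee_fin indicE.
    have [|_] := boolP (x \in cone_tail c setT); rewrite ?mulr0 ?mulr1.
      rewrite inE => -[cx _]; rewrite le_min !ge_min lexx/= lerXn2r ?orbT//.
      - by rewrite nnegrE ltW.
      - by rewrite nnegrE enorm_ge0.
      - exact: ltW.
    by rewrite le_min ler01 exprn_ge0 ?enorm_ge0.
have := measure_ge0 nu (cone_tail c setT).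
(* As [e] is positive, an infinite mass would make the product infinite. *)
by case: (nu _) => [r| |]//= _; rewrite ?ltry// mulry gtr0_sg// mul1e.
Qed.

End inversion.

Theorem theorem2p9 (R : realType) (d k : nat) (hk : k = 1%N \/ k = 2%N)
    (nu nu' : {measure set (Rd R d) -> \bar R}) :
  levy_measure k nu -> levy_measure k nu' ->
  (forall B : set (Rd R d), measurable B -> A_op k nu B = A_op k nu' B) ->
  forall B : set (Rd R d), measurable B -> nu B = nu' B.
Proof.
move=> L L' eqA; have [nu0 _] := L; have [nu'0 _] := L'.
apply: cone_tail_measure_unique => //.
  by move=> c; exact: (levy_cone_tail k).
by move=> c C; exact: (A_op_cone_tail k).
Qed.
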